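(* Let $(A,\le,0,1)$ be a bounded poset satisfying both the Ascending Chain Condition and the Descending Chain Condition, let $(T,R)$ be a time frame with $R$ serial, and let $P,F,H,G$ be the tense operators induced by $(T,R)$. Then for all $B,C\in\mathcal P_+(A^T)$: (1) $P(B\odot B)=P(B)$ and $F(B\odot B)=F(B)$; (2) $\operatorname{Max}L(P(B\odot C))\le_1\operatorname{Max}L(P(B))\odot\operatorname{Max}L(P(C))$; (3) $\operatorname{Max}L(F(B\odot C))\le_1\operatorname{Max}L(F(B))\odot\operatorname{Max}L(F(C))$.
   Context: ACC: no infinite strictly ascending chains; DCC: no infinite strictly descending chains. For $X\subseteq A$: $L(X)$, $U(X)$ the sets of lower/upper bounds, $\operatorname{Max}X,\operatorname{Min}X$ the maximal/minimal elements. $\mathcal P_+(X)$ = nonempty subsets. For subsets $X,Y$: $X\le Y$ iff $x\le y$ for all $x\in X,y\in Y$; $X\le_1Y$ iff every $x\in X$ lies below some $y\in Y$; $X\le_2Y$ iff every $y\in Y$ lies above some $x\in X$. Connectives: for $x,y\in A$, $x\odot y=\operatorname{Max}L(\{x,y\})$; for nonempty $B,C\subseteq A$, $B\odot C=\operatorname{Max}\{a\in A\mid a\le U(\bigcup\{b\odot c\mid b\in B,c\in C\})\}$. For $B,C\in(\mathcal P_+A)^T$, $(B\odot C)(t)=B(t)\odot C(t)$; for $B\subseteq A^T$, $B(t)=\{q(t)\mid q\in B\}$, so $B\odot C$ is defined for $B,C\in\mathcal P_+(A^T)$ as the function $t\mapsto B(t)\odot C(t)$. For a function $Z$ from $T$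 to subsets of $A$, $L(Z)$ and $\operatorname{Max}L(Z)$ are taken pointwise, and $\le_1$ between such functions is pointwise in $t$. A time frame is $(T,R)$, $T\ne\emptyset$, $R\subseteq T^2$; serial: each $s$ has $r,t$ with $rRs$, $sRt$. The induced tense operators $P,F,H,G:\mathcal P_+(A^T)\to(\mathcal P_+A)^T$ are $P(B)(s)=\operatorname{Min}U(\{q(t)\mid q\in B, tRs\})$, $F(B)(s)=\operatorname{Min}U(\{q(t)\mid q\in B, sRt\})$, $H(B)(s)=\operatorname{Max}L(\{q(t)\mid q\in B,tRs\})$, $G(B)(s)=\operatorname{Max}L(\{q(t)\mid q\in B,sRt\})$. An element $Z\in(\mathcal P_+A)^T$ is fed to these operators as the subset $\{q\in A^T\mid q(t)\in Z(t)\ \forall t\}$ of $A^T$. *)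

(* Defs.v *)
From mathcomp Require Import all_boot all_order.
From mathcomp Require Import boolp classical_sets.

Set Implicit Arguments.
Unset Strict Implicit.
Unset Printing Implicit Defensive.

Import Order.TTheory.
Local Open Scope classical_set_scope.
Local Open Scope order_scope.

(* U(X) and L(X) are the library's [ubound X] and [lbound X]. *)

Definition ACC_on {d} (A : porderType d) : Prop :=
  ~ exists f : nat -> A, forall n, f n < f n.+1.

Definition DCC_on {d} (A : porderType d) : Prop :=
  ~ exists f : nat -> A, forall n, f n.+1 < f n.

Section Poset.
Context {d : Order.disp_t} {A : porderType d}.
Implicit Types (X Y B C : set A) (x y a b c : A).

Definition Maxs X : set A := [set a | X a /\ forall b, X b -> ~ (a < b)].

Definition Mins X : set A := [set a | X a /\ forall b, X b -> ~ (b < a)].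

Definition le1 X Y : Prop := forall x, X x -> exists2 y, Y y & x <= y.

Definition odot_elt x y : set A := Maxs (lbound [set x; y]).

(* The set {a | a <= U(X)} is L(U(X)). *)
Definition odot B C : set A :=
  Maxs (lbound (ubound (\bigcup_(b in B) \bigcup_(c in C) odot_elt b c))).

End Poset.

Section Tense.
Context {d : Order.disp_t} {A : porderType d} {T : Type}.
Implicit Types (Z W : T -> set A) (B C : set (T -> A)) (s t : T).

Definition vals B : T -> set A := fun t => [set q t | q in B].

Definition fodot Z W : T -> set A := fun t => odot (Z t) (W t).

Definition sodot B C : T -> set A := fodot (vals B) (vals C).

Definition fMaxL Z : T -> set A := fun t => Maxs (lbound (Z t)).

Definition fle1 Z W : Prop := forall t, le1 (Z t) (W t).

(* The subset of A^T as which an element of (P_+ A)^T is fed to P, F, H, G. *)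
Definition selections Z : set (T -> A) := [set q | forall t, Z t (q t)].

Definition serial (R : T -> T -> Prop) : Prop :=
  forall s, (exists r, R r s) /\ (exists t, R s t).

Definition past_vals (R : T -> T -> Prop) B s : set A :=
  [set a | exists q t, [/\ B q, R t s & a = q t]].

Definition future_vals (R : T -> T -> Prop) B s : set A :=
  [set a | exists q t, [/\ B q, R s t & a = q t]].

Definition tenseP R B : T -> set A := fun s => Mins (ubound (past_vals R B s)).
Definition tenseF R B : T -> set A := fun s => Mins (ubound (future_vals R B s)).
Definition tenseH R B : T -> set A := fun s => Maxs (lbound (past_vals R B s)).
Definition tenseG R B : T -> set A := fun s => Maxs (lbound (future_vals R B s)).

End Tense.

(* Under ACC and DCC the values of all these operations are nonempty, so
   using [set _] for their codomains agrees with P_+(A) and P_+(A^T). *)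

Lemma ACC_Maxs_above d (A : porderType d) (X : set A) x :
  ACC_on A -> X x -> exists2 m, Maxs X m & x <= m.
Proof.
move=> acc Xx; apply: contrapT => nom; apply: acc.
pose S := {a : A | X a /\ x <= a}.
have step (u : S) : {v : S | sval u < sval v}.
  apply: cid; case: u => a [Xa xa] /=; apply: contrapT => nov; apply: nom.
  exists a => //; split=> // b Xb ab; apply: nov.
  by exists (exist _ b (conj Xb (le_trans xa (ltW ab)))).
have [f [_ fS]] := dependent_choice step (exist _ x (conj Xx (lexx x)) : S).
by exists (fun n => sval (f n)).
Qed.

Lemma DCC_Mins_below d (A : porderType d) (X : set A) x :
  DCC_on A -> X x -> exists2 m, Mins X m & m <= x.
Proof.
move=> dcc Xx; apply: contrapT => nom; apply: dcc.
pose S := {a : A | X a /\ a <= x}.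
have step (u : S) : {v : S | sval v < sval u}.
  apply: cid; case: u => a [Xa ax] /=; apply: contrapT => nov; apply: nom.
  exists a => //; split=> // b Xb ba; apply: nov.
  by exists (exist _ b (conj Xb (le_trans (ltW ba) ax))).
have [f [_ fS]] := dependent_choice step (exist _ x (conj Xx (lexx x)) : S).
by exists (fun n => sval (f n)).
Qed.

Section Nonempty.
Context {d : Order.disp_t} {A : tbPOrderType d} {T : Type}.
Hypotheses (acc : ACC_on A) (dcc : DCC_on A).

Lemma MaxsL_neq0 (X : set A) : Maxs (lbound X) !=set0.
Proof.
have L0 : lbound X \bot by move=> x _; exact: le0x.
by have [m Mm _] := ACC_Maxs_above acc L0; exists m.
Qed.

Lemma MinsU_neq0 (X : set A) : Mins (ubound X) !=set0.
Proof.
have U1 : ubound X \top by move=> x _; exact: lex1.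
by have [m Mm _] := DCC_Mins_below dcc U1; exists m.
Qed.

Lemma tenseP_neq0 (R : T -> T -> Prop) B s : tenseP (A := A) R B s !=set0.
Proof. exact: MinsU_neq0. Qed.

Lemma tenseF_neq0 (R : T -> T -> Prop) B s : tenseF (A := A) R B s !=set0.
Proof. exact: MinsU_neq0. Qed.

Lemma tenseH_neq0 (R : T -> T -> Prop) B s : tenseH (A := A) R B s !=set0.
Proof. exact: MaxsL_neq0. Qed.

Lemma tenseG_neq0 (R : T -> T -> Prop) B s : tenseG (A := A) R B s !=set0.
Proof. exact: MaxsL_neq0. Qed.

Lemma odot_neq0 (B C : set A) : odot B C !=set0.
Proof. exact: MaxsL_neq0. Qed.

Lemma selections_neq0 (Z : T -> set A) :
  (forall t, Z t !=set0) -> selections Z !=set0.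
Proof. by move=> /choice[q Zq]; exists q. Qed.

End Nonempty.

(* Main.v *)
(** The chain conditions give [U(Max X) = U(X)] and [L(Min X) = L(X)], and
    [U L U = U], so [B odot C] has the same upper bounds as the union of the
    [b odot c].  Each [b odot c] lies below both [b] and [c], and
    [b odot b = {b}], whence (1).  Moreover [Max L(F(B odot C))] is contained in
    [L U] of the future values of [B], and likewise of [C]; so each of its
    elements is below some [b] in [Max L(F(B))] and some [c] in [Max L(F(C))],
    hence below an element of [b odot c].  The operator [P] is [F] for the
    converse relation. *)

Require Import Defs.
From mathcomp Require Import all_boot all_order.
From mathcomp Require Import boolp classical_sets.

Local Open Scope classical_set_scope.

Import Order.TTheory.
Local Open Scope order_scope.

Section PosetBounds.
Context {d : Order.disp_t} {A : porderType d}.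
Implicit Types (X Y B C : set A).

Lemma ubound_Maxs X : ACC_on A -> ubound (Maxs X) = ubound X.
Proof.
move=> acc; apply/seteqP; split=> u Uu x Xx; last by apply: Uu; case: Xx.
by have [m Mm xm] := ACC_Maxs_above acc Xx; exact: le_trans xm (Uu _ Mm).
Qed.

Lemma lbound_Mins X : DCC_on A -> lbound (Mins X) = lbound X.
Proof.
move=> dcc; apply/seteqP; split=> l Ll x Xx; last by apply: Ll; case: Xx.
by have [m Mm mx] := DCC_Mins_below dcc Xx; exact: le_trans (Ll _ Mm) mx.
Qed.

Lemma ubound_lbound_ubound X : ubound (lbound (ubound X)) = ubound X.
Proof.
apply/seteqP; split=> u Uu x Xx; last exact: Xx.
by apply: Uu => v; apply.
Qed.

Lemma lbound_ubound_sub X Y :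
  ubound Y `<=` ubound X -> lbound (ubound X) `<=` lbound (ubound Y).
Proof. by move=> YX l Ll u /YX /Ll. Qed.

(** Applied to a union over the related instants, this reduces every comparison of upper bounds to a
    single instant. *)
Lemma ubound_bigcup (I : Type) (D : set I) (X : I -> set A) :
  ubound (\bigcup_(i in D) X i) = \bigcap_(i in D) ubound (X i).
Proof.
apply/seteqP; split=> u Uu; first by move=> i Di x Xx; apply: Uu; exists i.
by move=> x [i Di Xx]; exact: Uu Xx.
Qed.

Lemma ubound_odot B C : ACC_on A ->
  ubound (odot B C) = ubound (\bigcup_(b in B) \bigcup_(c in C) odot_elt b c).
Proof. by move=> acc; rewrite ubound_Maxs// ubound_lbound_ubound. Qed.

Lemma ubound_odot_l B C : ACC_on A -> ubound B `<=` ubound (odot B C).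
Proof.
move=> acc u Uu; rewrite ubound_odot// => x [b Bb [c _ [Lx _]]].
by apply: le_trans (Uu _ Bb); apply: Lx; left.
Qed.

Lemma ubound_odot_r B C : ACC_on A -> ubound C `<=` ubound (odot B C).
Proof.
move=> acc u Uu; rewrite ubound_odot// => x [b _ [c Cc [Lx _]]].
by apply: le_trans (Uu _ Cc); apply: Lx; right.
Qed.

(** Since [a] is itself the greatest lower bound of [[set a; a]]. Membership is enough for showing
    that an upper bound of the union bounds [B]. *)
Lemma odot_elt_self (a : A) : odot_elt a a a.
Proof.
split=> [_ [] ->//|b Lb ab].
by have := lt_le_trans ab (Lb a (or_introl erefl)); rewrite ltxx.
Qed.

Lemma ubound_odot_self B : ACC_on A -> ubound (odot B B) = ubound B.
Proof.
move=> acc; apply/seteqP; split; last exact: ubound_odot_l.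
move=> u; rewrite ubound_odot// => Uu b Bb; apply: Uu.
by exists b => //; exists b => //; exact: odot_elt_self.
Qed.

(** ACC is used twice: a common lower bound [x] of [b] and [c] lies below some [m] in
    [odot_elt b c], which puts [x] in the [L U] of the union; [x] then lies below a maximal element
    of that set. *)
Lemma le1_odot X B C : ACC_on A -> le1 X B -> le1 X C -> le1 X (odot B C).
Proof.
move=> acc XB XC x Xx; have [b Bb xb] := XB _ Xx; have [c Cc xc] := XC _ Xx.
have Lx : lbound [set b; c] x by move=> _ [] ->.
have [m mbc xm] := ACC_Maxs_above acc Lx.
have LUx : lbound (ubound (\bigcup_(b in B) \bigcup_(c in C) odot_elt b c)) x.
  by move=> u Uu; apply: le_trans xm (Uu _ _); exists b => //; exists c.
by have [y My xy] := ACC_Maxs_above acc LUx; exists y.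
Qed.

End PosetBounds.

Section Future.
Context {d : Order.disp_t} {A : tbPOrderType d} {T : Type}.
Hypotheses (acc : ACC_on A) (dcc : DCC_on A).
Implicit Types (R : T -> T -> Prop) (B C : set (T -> A)) (Z : T -> set A).

Lemma future_vals_bigcup R B s :
  future_vals R B s = \bigcup_(t in [set t | R s t]) vals B t.
Proof.
apply/seteqP; split=> a /=.
  by move=> [q [t [Bq Rst ->]]]; exists t => //; exists q.
by move=> [t Rst [q Bq <-]]; exists q, t.
Qed.

(** Encoding [Z] by its selections loses no value: any [a] in [Z t] extends to a selection, because
    nonemptiness of the other [Z r] supplies values away from [t]. *)
Lemma vals_selections Z : (forall t, Z t !=set0) -> vals (selections Z) = Z.
Proof.
move=> /selections_neq0[q Zq]; apply/funext => t; apply/seteqP.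
split=> [_ [p Zp <-]|a Zta]; first exact: Zp.
(* The fixed selection [q] is altered at [t] only; equality of instants is decided classically. *)
exists (fun r => if pselect (r = t) then a else q r); last by case: pselect.
by move=> r; case: pselect => [e|_] /=; [rewrite e|exact: Zq].
Qed.

Lemma ubound_future_sodot R B C s :
  ubound (future_vals R (selections (sodot B C)) s) =
  \bigcap_(t in [set t | R s t]) ubound (odot (vals B t) (vals C t)).
Proof.
by rewrite future_vals_bigcup ubound_bigcup vals_selections// => t;
  exact: odot_neq0.
Qed.

Lemma ubound_future R B s : ubound (future_vals R B s) =
  \bigcap_(t in [set t | R s t]) ubound (vals B t).
Proof. by rewrite future_vals_bigcup ubound_bigcup. Qed.

(** [tenseF] sees its argument only through the upper bounds of the future values, and these agree
    instant by instant. *)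
Lemma tenseF_sodot_self R B : tenseF R (selections (sodot B B)) = tenseF R B.
Proof.
apply/funext => s; rewrite /tenseF ubound_future_sodot ubound_future.
by congr Mins; apply: eq_bigcapr => t _; exact: ubound_odot_self.
Qed.

Lemma fMaxL_tenseF R B s :
  fMaxL (tenseF R B) s = Maxs (lbound (ubound (future_vals R B s))).
Proof. by rewrite /fMaxL lbound_Mins. Qed.

(** Fewer upper bounds give more elements in [L U]; ACC then lifts each element of the smaller [L U]
    to a maximal one of the larger. *)
Lemma fMaxL_tenseF_le1 R B C s :
  ubound (future_vals R C s) `<=` ubound (future_vals R B s) ->
  le1 (fMaxL (tenseF R B) s) (fMaxL (tenseF R C) s).
Proof.
rewrite !fMaxL_tenseF => /lbound_ubound_sub BC x [/BC Lx _].
exact: ACC_Maxs_above Lx.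
Qed.

Lemma fMaxL_tenseF_sodot R B C :
  fle1 (fMaxL (tenseF R (selections (sodot B C))))
       (fodot (fMaxL (tenseF R B)) (fMaxL (tenseF R C))).
Proof.
move=> s; apply: le1_odot => //; apply: fMaxL_tenseF_le1;
  rewrite ubound_future_sodot ubound_future; apply: subset_bigcap => t _.
- exact: ubound_odot_l.
- exact: ubound_odot_r.
Qed.

End Future.

(** Both sides unfold to the same term, so the results on [tenseF], proved for arbitrary [R], carry
    over to [tenseP]. *)
Lemma tenseP_converse (d : Order.disp_t) (A : porderType d) (T : Type)
  (R : T -> T -> Prop) (B : set (T -> A)) :
  tenseP R B = tenseF (fun s t => R t s) B.
Proof. by []. Qed.

Theorem theorem6p4 (d : Order.disp_t) (A : tbPOrderType d)
  (hACC : ACC_on A) (hDCC : DCC_on A)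
  (T : Type) (hT : inhabited T) (R : T -> T -> Prop) (hR : serial R)
  (B C : set (T -> A)) (hB : B !=set0) (hC : C !=set0) :
  (tenseP R (selections (sodot B B)) = tenseP R B /\
   tenseF R (selections (sodot B B)) = tenseF R B) /\
  fle1 (fMaxL (tenseP R (selections (sodot B C))))
       (fodot (fMaxL (tenseP R B)) (fMaxL (tenseP R C))) /\
  fle1 (fMaxL (tenseF R (selections (sodot B C))))
       (fodot (fMaxL (tenseF R B)) (fMaxL (tenseF R C))).
Proof.
rewrite !tenseP_converse.
by split; split; try exact: tenseF_sodot_self; exact: fMaxL_tenseF_sodot.
Qed.
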